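(* Let $p,q>0$ be real numbers and consider the system $$x_{n+1}=\frac{p\,x_{n-1}+q}{y_nx_{n-1}},\qquad y_{n+1}=\frac{p\,y_{n-1}+q}{x_ny_{n-1}},\qquad n=0,1,2,\ldots,$$ with initial values $x_{-1},x_0\in I=(0,+\infty)$ and $y_{-1},y_0\in J=(0,+\infty)$. Then the equilibrium point $$E=\left(\frac{R^2+12p}{6R},\ \frac{R^2+12p}{6R}\right),\qquad R=\sqrt[3]{108q+12\sqrt{-12p^3+81q^2}},$$ of this system is a global attractor.
   Context: The system is the rewriting, with $p=\alpha/\gamma$ and $q=\beta/\gamma$, of $x_{n+1}=\frac{\alpha x_{n-1}+\beta}{\gamma y_nx_{n-1}}$, $y_{n+1}=\frac{\alpha y_{n-1}+\beta}{\gamma x_ny_{n-1}}$ with $\alpha,\beta,\gamma>0$. If $-12p^3+81q^2<0$, the square and cube roots in $R$ are the principal ones in $\mathbb{C}$. An equilibrium point of the system is $(\overline{x},\overline{y})\in I\times J$ with $\overline{x}=\frac{p\overline{x}+q}{\overline{y}\,\overline{x}}$ and $\overline{y}=\frac{p\overline{y}+q}{\overline{x}\,\overline{y}}$. Put $W_n=(x_n,x_{n-1},y_n,y_{n-1})^T$ and $\overline{W}=(\overline{x},\overline{x},\overline{y},\overline{y})^T$. The equilibrium $(\overline{x},\overline{y})$ is a global attractor if for every $W_0\in I^2\times J^2$ one has $\|W_n-\overline{W}\|\to 0$ as $n\to+\infty$ (for any norm). *)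

(* Defs.v *)
From mathcomp Require Import all_boot all_order all_algebra.
From mathcomp Require Import complex.
From mathcomp Require Import all_classical all_reals all_analysis.
Import Order.TTheory GRing.Theory Num.Theory.
Import numFieldNormedType.Exports.
Set Implicit Arguments.
Unset Strict Implicit.
Unset Printing Implicit Defensive.

Local Open Scope ring_scope.
Local Open Scope classical_set_scope.
Local Open Scope complex_scope.

(* Sequences start at index -1: [x k] stands for x_{k-1}, so that [x 0] and
   [x 1] are the initial values x_{-1} and x_0. *)
Definition is_solution (R : realType) (p q : R) (x y : nat -> R) : Prop :=
  forall n : nat,
    x n.+2 = (p * x n + q) / (y n.+1 * x n) /\
    y n.+2 = (p * y n + q) / (x n.+1 * y n).

Definition is_equilibrium (R : realType) (p q xbar ybar : R) : Prop :=
  [/\ 0 < xbar, 0 < ybar,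
      xbar = (p * xbar + q) / (ybar * xbar) &
      ybar = (p * ybar + q) / (xbar * ybar)].

(* W_n = (x_n, x_{n-1}, y_n, y_{n-1})^T, with the index shift above. *)
Definition state (R : realType) (x y : nat -> R) (n : nat) : 'cV[R]_4 :=
  \col_(i < 4) [:: x n.+1; x n; y n.+1; y n]`_i.

Definition eq_state (R : realType) (xbar ybar : R) : 'cV[R]_4 :=
  \col_(i < 4) [:: xbar; xbar; ybar; ybar]`_i.

Definition is_norm (R : realType) (m : nat) (N : 'cV[R]_m -> R) : Prop :=
  [/\ forall v, 0 <= N v,
      forall v, N v = 0 -> v = 0,
      forall (a : R) v, N (a *: v) = `|a| * N v &
      forall v w, N (v + w) <= N v + N w].

Definition global_attractor (R : realType) (p q xbar ybar : R) : Prop :=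
  forall x y : nat -> R,
    0 < x 0 -> 0 < x 1 -> 0 < y 0 -> 0 < y 1 ->
    is_solution p q x y ->
    forall N : 'cV[R]_4 -> R, is_norm N ->
      N (state x y n - eq_state xbar ybar) @[n --> \oo] --> (0 : R).

Definition modulus (R : realType) (z : R[i]) : R :=
  Num.sqrt (complex.Re z ^+ 2 + complex.Im z ^+ 2).

(* Principal argument, with values in ]-pi, pi]; it is pi / 2 at z = 0. *)
Definition principal_arg (R : realType) (z : R[i]) : R :=
  let t := acos (complex.Re z / modulus z) in
  if 0 <= complex.Im z then t else - t.

(* Principal k-th root |z|^(1/k) exp(i Arg(z) / k), for k > 0. It is the usual
   real k-th root when z is a nonnegative real, including 0 at z = 0. *)
Definition principal_root (R : realType) (k : nat) (z : R[i]) : R[i] :=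
  let r := modulus z `^ (k%:R)^-1 in
  let t := principal_arg z / k%:R in
  (r * cos t) +i* (r * sin t).

(* When the discriminant is nonnegative both radicands are nonnegative reals,
   so the roots below are then the real ones. *)
Definition cardano_root (R : realType) (p q : R) : R[i] :=
  principal_root 3
    ((108 * q)%:C +
     12 * principal_root 2 (- 12 * p ^+ 3 + 81 * q ^+ 2)%:C).

(* Main.v *)
(* Interleaving [x] and [y] by parity decouples the system into two copies of
   z_(n+1) = (p z_(n-1) + q) / (z_n z_(n-1)). Writing z_n = u_(n+1) / u_n makes
   this the linear recurrence u_(n+3) = p u_(n+1) + q u_n, whose dominant
   eigenvalue is the positive root rho of X^3 = p X + q. The normalized terms
   t_n = u_n / rho^n satisfy a recurrence with convex weights, so they stay
   bounded away from 0, while their increments satisfy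
   d_(n+2) = - d_(n+1) - b d_n with b = q / rho^3 in ]0, 1[ and decay
   geometrically; hence z_n = rho t_(n+1) / t_n tends to rho. Cardano's formula
   identifies rho with the coordinate of E: for a negative discriminant
   |R|^2 = 12 p, so that coordinate is (R + conj R) / 6 = Re R / 3. *)
Require Import Defs.
From mathcomp Require Import all_boot all_order all_algebra.
From mathcomp Require Import complex.
From mathcomp Require Import all_classical all_reals all_analysis.
From mathcomp Require Import ring lra.
Import Order.TTheory GRing.Theory Num.Theory.
Import numFieldNormedType.Exports.
Local Open Scope classical_set_scope.
Local Open Scope ring_scope.
Local Open Scope complex_scope.

(** * Decay of linear recurrences by a quadratic Lyapunov form *)

(** Equal to [x^2 + b (x + y)^2 + (b y)^2], so for [b >= 0] it dominates [x^2]. *)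
Definition lyapunov (R : realFieldType) (b x y : R) : R :=
  (1 + b) * x ^+ 2 + 2 * b * (x * y) + b * (1 + b) * y ^+ 2.

(* The companion map of [mu ^ 2 + mu + b] strictly contracts [lyapunov R b]; the
   cross coefficient is chosen so that the decrement is diagonal. *)
Lemma lyapunov_contract (R : realFieldType) (b x y : R) :
  0 < b -> b < 1 ->
  lyapunov R b (- x - b * y) x <= (1 - b * (1 - b) / 3) * lyapunov R b x y.
Proof.
move=> b0 b1; set V := lyapunov R b.
(* One step lowers [V] by exactly [b (1 - b)] times this diagonal form, so the bound by 3 times the
   form yields the contraction factor. *)
have hV : V x y <= 3 * (x ^+ 2 + (1 + b) * y ^+ 2).
  have h1 : 0 <= b * (x - y) ^+ 2 by rewrite mulr_ge0 ?sqr_ge0 ?ltW.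
  have h2 : 0 <= (1 - b) * x ^+ 2 by rewrite mulr_ge0 ?sqr_ge0 ?subr_ge0 ?ltW.
  have h3 : 0 <= (1 - b) * (1 + b) * y ^+ 2.
    by rewrite mulr_ge0 ?sqr_ge0 ?mulr_ge0 ?subr_ge0 ?addr_ge0 ?ltW.
  have h4 : 0 <= (2 + b) * y ^+ 2 by rewrite mulr_ge0 ?sqr_ge0 ?addr_ge0 ?ltW.
  have h5 : 0 <= x ^+ 2 by rewrite sqr_ge0.
  have h6 : 0 <= y ^+ 2 by rewrite sqr_ge0.
  rewrite /V /lyapunov; lra.
have -> : V (- x - b * y) x =
    V x y - b * (1 - b) * (x ^+ 2 + (1 + b) * y ^+ 2) by rewrite /V /lyapunov; ring.
have c0 : 0 <= b * (1 - b) by rewrite mulr_ge0 ?subr_ge0 ?ltW.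
have := ler_wpM2l c0 hV; lra.
Qed.

(** The roots of [mu^2 + mu + b] may be real, double or complex; the quadratic form treats these
    cases at once. *)
Lemma linear_recurrence_cvg0 (R : realType) (b : R) (d : nat -> R) :
  0 < b -> b < 1 ->
  (forall n, d n.+2 = - d n.+1 - b * d n) ->
  d n @[n --> \oo] --> (0 : R).
Proof.
move=> b0 b1 dE.
pose V := lyapunov R b.
pose c := 1 - b * (1 - b) / 3.
have bb : 0 < b * (1 - b) by rewrite mulr_gt0 ?subr_gt0.
have bb1 : b * (1 - b) <= b by rewrite ler_piMr ?ltW //; lra.
have c0 : 0 < c by rewrite /c; lra.
have c1 : c < 1 by rewrite /c; lra.
have Vn n : V (d n.+1) (d n) <= V (d 1) (d 0) * c ^+ n.
  elim: n => [|n IHn]; first by rewrite expr0 mulr1.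
  have := lyapunov_contract R b (d n.+1) (d n) b0 b1.
  rewrite -dE => /le_trans; apply.
  by rewrite exprS mulrCA ler_wpM2l // ltW.
have dV n : d n.+1 ^+ 2 <= V (d n.+1) (d n).
  have h1 : 0 <= b * (d n.+1 + d n) ^+ 2 by rewrite mulr_ge0 ?sqr_ge0 ?ltW.
  have h2 : 0 <= (b * d n) ^+ 2 by rewrite sqr_ge0.
  rewrite /V /lyapunov; lra.
have sq0 : (d n.+1 ^+ 2) @[n --> \oo] --> (0 : R).
  apply: (@squeeze_cvgr _ _ _ _ (cst 0) (fun n => V (d 1) (d 0) * c ^+ n)).
  - by apply: nearW => n; rewrite sqr_ge0 /=; apply: le_trans (Vn n).
  - exact: cvg_cst.
  - rewrite -[X in _ --> X](mulr0 (V (d 1) (d 0))).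
    by apply: cvgM; first exact: cvg_cst; apply: cvg_expr; rewrite ger0_norm // ltW.
rewrite -(cvg_shiftS d).
apply/norm_cvg0P.
have -> : (fun n => `|d n.+1|) = (fun n => Num.sqrt (d n.+1 ^+ 2)).
  by apply/funext => n; rewrite sqrtr_sqr.
rewrite -[X in _ --> X](@sqrtr0 R).
by apply: continuous_cvg => //; exact: sqrt_continuous.
Qed.

Lemma convex_recurrence_lower_bound (R : realFieldType) (a b m : R)
    (t : nat -> R) :
  0 <= a -> 0 <= b -> a + b = 1 ->
  (forall n, t n.+3 = a * t n.+1 + b * t n) ->
  m <= t 0 -> m <= t 1 -> m <= t 2 -> forall n, m <= t n.
Proof.
move=> a0 b0 ab tE t0 t1 t2 n.
suff: [/\ m <= t n, m <= t n.+1 & m <= t n.+2] by case.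
elim: n => [//|n [h0 h1 h2]]; split => //.
rewrite tE -[m]mul1r -ab mulrDl.
by apply: lerD; apply: ler_wpM2l.
Qed.

(** * Convergence of the rational recurrence and of the system *)

Lemma scalar_cvg (R : realType) (p q rho : R) (z : nat -> R) :
  0 < p -> 0 < q -> 0 < rho -> rho ^+ 3 = p * rho + q ->
  0 < z 0 -> 0 < z 1 ->
  (forall n, z n.+2 = (p * z n + q) / (z n.+1 * z n)) ->
  z n @[n --> \oo] --> rho.
Proof.
move=> p0 q0 r0 rE z0 z1 zE.
have zpos n : 0 < z n.
  suff: 0 < z n /\ 0 < z n.+1 by case.
  elim: n => [//|n [h0 h1]]; split => //.
  by rewrite zE divr_gt0 ?addr_gt0 ?mulr_gt0.
have rn0 : rho != 0 by rewrite gt_eqF.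
(* This is [u_n / rho^n], with [u_0 = 1]. *)
pose t n := \prod_(i < n) (z i / rho).
have tS n : t n.+1 = t n * (z n / rho) by rewrite /t big_ord_recr.
have tpos n : 0 < t n by apply: prodr_gt0 => i _; rewrite divr_gt0.
pose a := p / rho ^+ 2; pose b := q / rho ^+ 3.
have a0 : 0 < a by rewrite divr_gt0 ?exprn_gt0.
have b0 : 0 < b by rewrite divr_gt0 ?exprn_gt0.
have ab : a + b = 1.
  by apply: (mulIf (expf_neq0 3 rn0)); rewrite mul1r {2}rE /a /b; field.
have tE n : t n.+3 = a * t n.+1 + b * t n.
  have zn0 : z n != 0 by rewrite gt_eqF.
  have zn1 : z n.+1 != 0 by rewrite gt_eqF.
  by rewrite !tS zE /a /b; field; rewrite rn0 zn0 zn1.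
pose d n := t n.+1 - t n.
(* Since [a + b = 1], [X^3 - a X - b = (X - 1) (X^2 + X + b)]; taking differences removes the
   eigenvalue 1. *)
have dE n : d n.+2 = - d n.+1 - b * d n.
  have aE : a = 1 - b by rewrite -ab addrK.
  by rewrite /d tE aE; ring.
have b1 : b < 1 by rewrite -ab ltrDr.
have d0 := linear_recurrence_cvg0 R b d b0 b1 dE.
pose m := Num.min (t 0) (Num.min (t 1) (t 2)).
have m0 : 0 < m by rewrite !lt_min !tpos.
have mt n : m <= t n.
  by apply: (convex_recurrence_lower_bound R a b m t) => //;
    (exact: ltW || rewrite /m !ge_min lexx ?orbT).
apply/subr_cvg0/norm_cvg0P.
apply: (@squeeze_cvgr _ _ _ _ (cst 0) (fun n => rho / m * `|d n|)).
- apply: nearW => n; rewrite normr_ge0 /=.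
  have tn0 : t n != 0 by rewrite gt_eqF.
  have -> : z n - rho = rho / t n * d n.
    by rewrite /d tS; field; rewrite rn0 tn0.
  rewrite normrM ler_wpM2r // gtr0_norm ?divr_gt0 //.
  by rewrite ler_wpM2l ?(ltW r0) // lef_pV2 ?posrE.
- exact: cvg_cst.
- rewrite -[X in _ --> X](mulr0 (rho / m)).
  by apply: cvgM; first exact: cvg_cst; apply/norm_cvg0P.
Qed.

Lemma solution_cvg (R : realType) (p q rho : R) (x y : nat -> R) :
  0 < p -> 0 < q -> 0 < rho -> rho ^+ 3 = p * rho + q ->
  0 < x 0 -> 0 < x 1 -> 0 < y 0 -> 0 < y 1 ->
  is_solution p q x y ->
  x n @[n --> \oo] --> rho /\ y n @[n --> \oo] --> rho.
Proof.
move=> p0 q0 r0 rE x0 x1 y0 y1 xyE.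
have z : (if odd n then y n else x n) @[n --> \oo] --> rho.
  apply: (scalar_cvg R p q) => // n.
  by have [] := xyE n; rewrite /=; case: (odd n).
have w : (if odd n then x n else y n) @[n --> \oo] --> rho.
  apply: (scalar_cvg R p q) => // n.
  by have [] := xyE n; rewrite /=; case: (odd n).
(* For either parity of [n], this sum contains both [|x n - rho|] and [|y n - rho|], so one squeeze
   undoes the interleaving. *)
have s : (`|(if odd n then y n else x n) - rho| +
          `|(if odd n then x n else y n) - rho|) @[n --> \oo] --> (0 : R).
  rewrite -[X in _ --> X](addr0 (0 : R)).
  by apply: cvgD; apply/norm_cvg0P/subr_cvg0.
split; apply/subr_cvg0/norm_cvg0P;
  (apply: (squeeze_cvgr _ (cvg_cst (0 : R)) s));
  by apply: nearW => n; rewrite normr_ge0; case: odd;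
    rewrite /= ?lerDl ?lerDr normr_ge0.
Qed.

(** Any norm is dominated by the sum of the absolute coordinates weighted by the norms of the basis
    vectors. *)
Lemma is_norm_cvg0 (R : realType) (m : nat) (N : 'cV[R]_m -> R)
    (v : nat -> 'cV[R]_m) :
  is_norm N -> (forall i, v n i ord0 @[n --> \oo] --> (0 : R)) ->
  N (v n) @[n --> \oo] --> (0 : R).
Proof.
move=> [N_ge0 _ NZ ND] v0.
have N0 : N 0 = 0 by rewrite -(scale0r (0 : 'cV[R]_m)) NZ normr0 mul0r.
have N_sum (w : 'cV[R]_m) :
    N w <= \sum_i `|w i ord0| * N (delta_mx i ord0).
  have {1}-> : w = \sum_i w i ord0 *: delta_mx i ord0.
    rewrite {1}[w]matrix_sum_delta; apply: eq_bigr => i _.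
    by rewrite big_ord1.
  elim/big_rec2: _ => [|i a b _ IH]; first by rewrite N0.
  by rewrite (le_trans (ND _ _)) // NZ lerD2l.
apply: (@squeeze_cvgr _ _ _ _ (cst 0)
  (fun n => \sum_i `|v n i ord0| * N (delta_mx i ord0))).
- by apply: nearW => n; rewrite N_ge0 N_sum.
- exact: cvg_cst.
- rewrite [X in _ --> X](_ : 0 = \sum_(i < m) 0 * N (delta_mx i ord0));
    last by rewrite big1 // => i _; rewrite mul0r.
  apply: (cvg_big (@add_continuous R)) => i _.
  by apply: cvgM; [apply/norm_cvg0P | exact: cvg_cst].
Qed.

Lemma solution_global_attractor (R : realType) (p q rho : R) :
  0 < p -> 0 < q -> 0 < rho -> rho ^+ 3 = p * rho + q ->
  global_attractor p q rho rho.
Proof.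
move=> p0 q0 r0 rE x y x0 x1 y0 y1 xyE N normN.
have [xc yc] := solution_cvg R p q rho x y p0 q0 r0 rE x0 x1 y0 y1 xyE.
apply: is_norm_cvg0 => // i.
have step (u : nat -> R) : u n @[n --> \oo] --> rho ->
    u n - rho @[n --> \oo] --> (0 : R) /\
    u n.+1 - rho @[n --> \oo] --> (0 : R).
  move=> uc; split; apply/subr_cvg0 => //.
  by rewrite (cvg_shiftS u).
have [[x'0 x'1] [y'0 y'1]] := (step x xc, step y yc).
rewrite /state /eq_state.
case: i => [[|[|[|[|//]]]] i4].
all: by under eq_fun do rewrite !mxE /=.
Qed.

(** * Principal roots and Cardano's formula *)

Lemma modulus_ge0 (R : realType) (z : R[i]) : 0 <= modulus z.
Proof. exact: sqrtr_ge0. Qed.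

Lemma modulus_sqr (R : realType) (z : R[i]) :
  modulus z ^+ 2 = complex.Re z ^+ 2 + complex.Im z ^+ 2.
Proof. by rewrite sqr_sqrtr // addr_ge0 ?sqr_ge0. Qed.

Lemma principal_root_nneg (R : realType) (k : nat) (x : R) :
  (0 < k)%N -> 0 <= x ->
  principal_root k x%:C = (x `^ (k%:R)^-1)%:C.
Proof.
move=> k0 x0.
have mx : modulus x%:C = x.
  by rewrite /modulus /= expr0n addr0 sqrtr_sqr ger0_norm.
rewrite /principal_root /principal_arg mx /= lexx.
(* At 0 the argument is [acos 0], not 0, but the factor [r] vanishes. *)
have [->|xn0] := eqVneq x 0.
  by rewrite powR0 ?invr_eq0 ?pnatr_eq0 ?gtn_eqF // !mul0r.
by rewrite divff // acos1 mul0r cos0 sin0 mulr1 mulr0.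
Qed.

Lemma principal_root2_neg (R : realType) (x : R) :
  x < 0 -> principal_root 2 x%:C = 0 +i* Num.sqrt (- x).
Proof.
move=> x0.
have mx : modulus x%:C = - x.
  by rewrite /modulus /= expr0n addr0 sqrtr_sqr ltr0_norm.
have xn0 : x != 0 by rewrite lt_eqF.
rewrite /principal_root /principal_arg mx /= lexx invrN mulrN divff //.
rewrite acosN1 cos_pihalf sin_pihalf mulr0 mulr1 powR12_sqrt //.
by rewrite oppr_ge0 ltW.
Qed.

Lemma real_complex_nat (R : realType) (n : nat) : (n%:R : R)%:C = n%:R.
Proof. exact: (rmorph_nat (real_complex R)). Qed.

Lemma real_complexD (R : realType) (a b : R) : (a + b)%:C = a%:C + b%:C.
Proof. exact: (rmorphD (real_complex R)). Qed.

Lemma real_complexM (R : realType) (a b : R) : (a * b)%:C = a%:C * b%:C.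
Proof. exact: (rmorphM (real_complex R)). Qed.

Lemma real_complexV (R : realType) (a : R) : (a^-1)%:C = (a%:C)^-1.
Proof. exact: (fmorphV (real_complex R)). Qed.

(* The argument of the root lies in [0, pi / 3], which gives the sign of [a]. *)
Lemma principal_root3_upper (R : realType) (z : R[i]) :
  z != 0 -> 0 <= complex.Im z ->
  let a := complex.Re (principal_root 3 z) in
  let b := complex.Im (principal_root 3 z) in
  [/\ 0 < a, (a ^+ 2 + b ^+ 2) ^+ 3 = modulus z ^+ 2 &
      a ^+ 3 - 3 * a * b ^+ 2 = complex.Re z].
Proof.
move=> z0 im0.
have m0 : 0 < modulus z.
  rewrite lt_neqAle modulus_ge0 andbT; apply: contra z0 => /eqP m0.
  have := modulus_sqr R z; rewrite -m0 expr0n /= => /esym/eqP.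
  rewrite paddr_eq0 ?sqr_ge0 // !sqrf_eq0.
  by case: (z) => u v; rewrite eq_complex.
rewrite /principal_root /principal_arg im0 /=.
set c := complex.Re z / modulus z; set t := acos c / 3.
set r := modulus z `^ 3^-1.
have r0 : 0 < r by rewrite powR_gt0.
have r3 : r ^+ 3 = modulus z.
  by rewrite /r -powR_mulrn ?powR_ge0 // -powRrM mulVf // powRr1 // ltW.
have c1 : -1 <= c <= 1.
  rewrite -ler_norml -(@ler_pXn2r _ 2) ?nnegrE // expr1n.
  rewrite real_normK ?num_real // /c expr_div_n ler_pdivrMr ?exprn_gt0 //.
  by rewrite mul1r modulus_sqr lerDl sqr_ge0.
have cos0 : 0 < cos t.
  have := @pi_gt0 R; have := acos_ge0 c1; have := acos_lepi c1.
  by move=> h1 h2 h3; apply: cos_gt0_pihalf; rewrite /t; apply/andP; split; lra.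
have cs := cos2Dsin2 t.
split.
- by rewrite mulr_gt0.
- by rewrite !exprMn -mulrDr cs mulr1 -r3 -!exprM.
(* Triple angle: [cos (3 t) = cos t ^ 3 - 3 cos t sin t ^ 2]. *)
- have ct : cos (t + t + t) = c.
    by rewrite (_ : t + t + t = acos c) ?acosK // /t; field.
  have -> : complex.Re z = r ^+ 3 * cos (t + t + t).
    by rewrite ct r3 /c mulrC divfK ?gt_eqF.
  have sE : sin t ^+ 2 = 1 - cos t ^+ 2 by rewrite -cs addrC addKr.
  rewrite !cosD sinD.
  transitivity (r ^+ 3 * (cos t ^+ 3 - 3 * cos t * sin t ^+ 2)); first by ring.
  by congr (_ * _); ring.
Qed.

(* E is written with complex numbers; the first two conjuncts say that its
   coordinates are the real numbers xbar and ybar. *)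
Theorem theorem6 (R : realType) (p q : R) (hp : 0 < p) (hq : 0 < q) :
  exists xbar ybar : R,
    [/\ xbar%:C = (cardano_root p q ^+ 2 + 12 * p%:C) / (6 * cardano_root p q),
        ybar%:C = (cardano_root p q ^+ 2 + 12 * p%:C) / (6 * cardano_root p q),
        is_equilibrium p q xbar ybar &
        global_attractor p q xbar ybar].
Proof.
suff [x [x0 xE xC]] : exists x : R,
    [/\ 0 < x, x ^+ 3 = p * x + q &
      x%:C = (cardano_root p q ^+ 2 + 12 * p%:C) / (6 * cardano_root p q)].
  have eqx : x = (p * x + q) / (x * x).
    by rewrite -xE; field; rewrite gt_eqF.
  by exists x, x; split => //; exact: solution_global_attractor.
set D := - 12 * p ^+ 3 + 81 * q ^+ 2.
have [D0|D0] := leP 0 D.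
- pose w := 108 * q + 12 * Num.sqrt D; pose r := w `^ 3^-1.
  have w0 : 0 < w by rewrite ltr_wpDr ?mulr_ge0 ?sqrtr_ge0 ?mulr_gt0.
  have r0 : 0 < r by rewrite powR_gt0.
  have rn0 : r != 0 by rewrite gt_eqF.
  have r3 : r ^+ 3 = w.
    by rewrite /r -powR_mulrn ?powR_ge0 // -powRrM mulVf // powRr1 // ltW.
  have rootE : cardano_root p q = r%:C.
    rewrite /cardano_root principal_root_nneg // powR12_sqrt //.
    rewrite -real_complex_nat -real_complexM -real_complexD.
    by rewrite principal_root_nneg // ltW.
  (* The resolvent quadratic of the cubic, satisfied by [w = r^3]; solving it for [q] reduces the
     cubic to an identity in [p] and [r]. *)
  have wE : w ^+ 2 + 1728 * p ^+ 3 = 216 * q * w.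
    have := sqr_sqrtr D0; rewrite /w /D => sE; ring: sE.
  exists ((r ^+ 2 + 12 * p) / (6 * r)); split.
  + by rewrite divr_gt0 ?addr_gt0 ?mulr_gt0 ?exprn_gt0.
  + have h : r ^+ 6 + 1728 * p ^+ 3 = 216 * q * r ^+ 3.
      by rewrite r3 -wE -r3; ring.
    have -> : q = (r ^+ 6 + 1728 * p ^+ 3) / (216 * r ^+ 3) by rewrite h; field.
    by field.
  + rewrite rootE !expr2.
    by rewrite !(real_complexM, real_complexD, real_complexV, real_complex_nat).
- set w := 108 * q +i* (12 * Num.sqrt (- D)).
  have w0 : w != 0 by rewrite eq_complex /= gt_eqF ?mulr_gt0.
  have imw : 0 <= complex.Im w by rewrite mulr_ge0 ?sqrtr_ge0.
  have rootE : cardano_root p q = principal_root 3 w.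
    rewrite /cardano_root principal_root2_neg //; congr principal_root.
    rewrite -real_complex_nat.
    by apply/eqP; rewrite eq_complex /=; apply/andP; split; apply/eqP; ring.
  have := principal_root3_upper R w w0 imw.
  rewrite -rootE; case: (cardano_root p q) => a b /= [a0 ab3 abq].
  (* Here [|w|^2 = (108 q)^2 - 144 D = (12 p)^3], and cubing is injective on nonnegative reals. *)
  have ab : a ^+ 2 + b ^+ 2 = 12 * p.
    apply: (@pexpIrn _ 3) => //;
      rewrite ?nnegrE ?addr_ge0 ?sqr_ge0 ?mulr_ge0 ?ltW //.
    by rewrite ab3 modulus_sqr /= !exprMn sqr_sqrtr ?oppr_ge0 ?ltW // /D; ring.
  exists (a / 3); split.
  + by rewrite divr_gt0.
  + have -> : p = (a ^+ 2 + b ^+ 2) / 12 by rewrite ab; field.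
    have -> : q = (a ^+ 3 - 3 * a * b ^+ 2) / 108 by rewrite abq; field.
    by field.
  + have root0 : a +i* b != 0 by rewrite eq_complex /= gt_eqF.
    (* With [z = a +i* b], the numerator becomes [z^2 + |z|^2 = 2 a z], and dividing by [6 z] leaves
       [a / 3]. *)
    have -> : 12 * p%:C = (a ^+ 2 + b ^+ 2)%:C.
      by rewrite ab real_complexM real_complex_nat.
    apply: (canRL (mulfK _)); first by rewrite mulf_neq0 ?pnatr_eq0.
    rewrite -real_complex_nat.
    by apply/eqP; rewrite eq_complex /=; apply/andP; split; apply/eqP; field.
Qed.
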